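(* Let $p$ be an odd prime and let $G$ be a finite powerful $p$-group of type $(2,\ldots,2)$, i.e. $G\in\mathcal{P}$. Suppose that $G$ has two powerful composition series $$1=H_0\lhd_{\mathcal P}H_1\lhd_{\mathcal P}\cdots\lhd_{\mathcal P}H_n=G\quad\text{and}\quad 1=K_0\lhd_{\mathcal P}K_1\lhd_{\mathcal P}\cdots\lhd_{\mathcal P}K_m=G.$$ Then $m=n$, and the powerfully simple factors $H_1/H_0,H_2/H_1,\ldots,H_n/H_{n-1}$ are isomorphic to $K_1/K_0,K_2/K_1,\ldots,K_n/K_{n-1}$ in some order.
   Context: $p$ is an odd prime; $G^{p^i}$ is the subgroup generated by all $p^i$-th powers of elements of $G$. A finite $p$-group $G$ is powerful if $[G,G]\le G^p$; a subgroup $H\le G$ is powerfully embedded in $G$ if $[H,G]\le H^p$. Every powerful $p$-group $G$ has a powerful basis, i.e. generators $a_1,\ldots,a_r$ with $G=\langle a_1\rangle\cdots\langle a_r\rangle$ and $|G|=o(a_1)\cdots o(a_r)$; the number of generators of each order is an invariant of $G$. $G$ is of type $(2,\ldots,2)$ if all the generators in a powerful basis have order $p^2$. $\mathcal{P}$ is the class of all powerful $p$-groups of type $(2,\ldots,2)$, the trivial group being included. $H\unlhd_{\mathcal P}G$ means $H,G\in\mathcal{P}$, $H\le G$ and $H$ is powerfully embedded in $G$; $H\lhd_{\mathcal P}G$ means in addition $H\neq G$. If $H\unlhd_{\mathcal P}G$ then $G/H\in\mathcal P$. A group $G\in\mathcal{P}$ is powerfully simple if $G\ne1$ and $H\lhd_{\mathcal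 P}G$ implies $H=1$. A powerful composition series of $G\in\mathcal P$ is a chain $1=H_0\lhd_{\mathcal P}H_1\lhd_{\mathcal P}\cdots\lhd_{\mathcal P}H_n=G$ in which all the factors $H_1/H_0,\ldots,H_n/H_{n-1}$ are powerfully simple. *)

(* Defs.v *)
From mathcomp Require Import all_boot all_fingroup all_solvable.

Set Implicit Arguments.
Unset Strict Implicit.
Unset Printing Implicit Defensive.

Local Open Scope group_scope.

Section PowerfulGroups.

Variables (p : nat) (gT : finGroupType).
Implicit Types (G H : {group gT}) (s : seq gT).

(* G^(p^i), generated by all p^i-th powers; unlike 'Mho^i(G), which reads the
   prime off #|G|, the prime p is explicit here. *)
Definition pow_subgroup (i : nat) G : {set gT} :=
  <<[set x ^+ (p ^ i)%N | x in G]>>.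

Definition powerful G : Prop :=
  p.-group G /\ [~: G, G] \subset pow_subgroup 1 G.

Definition powerfully_embedded H G : Prop :=
  H \subset G /\ [~: H, G] \subset pow_subgroup 1 H.

(* The first equation is a product of sets, taken in the order of s. *)
Definition powerful_basis G s : Prop :=
  \prod_(a <- s) <[a]> = G /\ #|G| = (\prod_(a <- s) #[a])%N.

(* The number of basis elements of each order is an invariant of G, so it is
   enough that some powerful basis consists of elements of order p^2. The
   trivial group has type (2,...,2), through the empty basis. *)
Definition type_2s G : Prop :=
  exists s, powerful_basis G s /\ {in s, forall a, #[a] = (p ^ 2)%N}.

Definition classP G : Prop := powerful G /\ type_2s G.

Definition normalP H G : Prop :=
  [/\ classP H, classP G & powerfully_embedded H G].

Definition proper_normalP H G : Prop := normalP H G /\ H != G.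

Definition powerfully_simple G : Prop :=
  [/\ classP G, G :!=: 1 & forall H, proper_normalP H G -> H :=: 1].

End PowerfulGroups.

(* A series H_0, ..., H_n; the values of H beyond n are irrelevant. *)
Definition powerful_composition_series (p : nat) (gT : finGroupType)
    (G : {group gT}) (n : nat) (H : nat -> {group gT}) : Prop :=
  [/\ H 0 :=: 1, H n :=: G,
      forall i, (i < n)%N -> proper_normalP p (H i) (H i.+1) &
      forall i, (i < n)%N -> powerfully_simple p (H i.+1 / H i)%G].

(* Main.v *)
(* In G every p-th power is central of order at most p, so x -> x^p induces an
   isomorphism from L = G / G^p onto G^p, and [x, y] = z^p defines a bilinear
   product on L.  Subgroups between G^p and G are then the subspaces of L, and
   powerful embedding means being an ideal; H in P and H G^p have the same p-th
   powers.  The map H -> H G^p thus turns a powerful composition series of G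
   into a composition series of the algebra L, to which the Jordan-Hoelder
   argument applies.  An isomorphism between the algebras of two groups Q, Q' in
   P lifts to Q ~ Q': its graph is a powerful subgroup of Q x Q', and a minimal
   supplement of the p-th powers in it is the graph of a group isomorphism. *)
Require Import Defs.
From mathcomp Require Import all_boot all_fingroup all_solvable.

Set Implicit Arguments.
Unset Strict Implicit.
Unset Printing Implicit Defensive.

Local Open Scope group_scope.

(** The diamond step cannot be carried out inside the class P: in C x C with C cyclic of order p^2
    and generators a, b, the subgroups <a> and <a b^p> belong to P, but they meet in <a^p>, of order
    p. Subgroups above G^p are closed under intersections and products, which is why the series is
    moved there. The algebra L is never constructed. A p-th root of [x, y] is determined only modulo
    G^p, so every statement about the product becomes a statement about elements: some z with [x, y]
    = z^p lies in the required subgroup. Likewise an isomorphism is a relation between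
    representatives. This also allows comparing sections of G with the factors H_{i+1}/H_i, which
    live in unrelated quotient types. Membership in P returns only at the two ends: in showing that
    a powerfully simple factor yields a maximal ideal, and in lifting algebra isomorphisms to group
    isomorphisms. Both rest on the same minimal supplement. *)

Definition ppowers (p : nat) (gT : finGroupType) (A : {set gT}) : {set gT} :=
  [set x ^+ p | x in A].

Lemma ppowersS p (gT : finGroupType) (A B : {set gT}) :
  A \subset B -> ppowers p A \subset ppowers p B.
Proof. exact: imsetS. Qed.

Lemma mem_ppowers p (gT : finGroupType) (A : {set gT}) x :
  x \in A -> x ^+ p \in ppowers p A.
Proof. exact: imset_f. Qed.

Lemma pow_subgroup1 p (gT : finGroupType) (G : {group gT}) :
  pow_subgroup p 1 G = <<ppowers p G>>.
Proof. by rewrite /pow_subgroup expn1. Qed.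

Canonical pow_subgroup_group p (gT : finGroupType) i (G : {group gT}) :=
  Eval hnf in [group of pow_subgroup p i G].

(* A basis-free form of [classP p Q]: for a powerful group, having type (2,...,2)
   means that the p-th powers are exactly the solutions of x ^+ p = 1. *)
Record hclass2 (p : nat) (gT : finGroupType) (Q : {group gT}) : Prop :=
  Hclass2 {
    hclass2_pgroup : p.-group Q;
    hclass2_comm : {in Q &, forall x y, [~ x, y] \in ppowers p Q};
    hclass2_central : {in Q &, forall x y, commute (x ^+ p) y};
    hclass2_exp : {in Q, forall x, x ^+ p ^+ p = 1};
    hclass2_Ohm : {in Q, forall x, x ^+ p = 1 -> x \in ppowers p Q} }.

Lemma ppowers1 p (gT : finGroupType) (A : {group gT}) : 1 \in ppowers p A.
Proof. by rewrite -(expg1n _ p) mem_ppowers. Qed.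

Lemma ppowers_sub p (gT : finGroupType) (A : {group gT}) : ppowers p A \subset A.
Proof. by apply/subsetP=> _ /imsetP[x Ax ->]; apply: groupX. Qed.

Lemma expg_pair (aT rT : finGroupType) (x : aT) (y : rT) n :
  (x, y) ^+ n = (x ^+ n, y ^+ n).
Proof. by elim: n => // n IHn; rewrite !expgS IHn. Qed.

Lemma center_commute (gT : finGroupType) (G : {group gT}) x y :
  x \in 'Z(G) -> y \in G -> commute x y.
Proof. by case/setIP=> _ /centP; apply. Qed.

(** Converts equality of two multisets of labels into a permutation of the indices, the form in
    which factors are finally matched. *)
Lemma perm_eq_mkseq (T : eqType) n (f g : nat -> T) :
  perm_eq (mkseq f n) (mkseq g n) ->
  exists s : {perm 'I_n}, forall i : 'I_n, f i = g (s i).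
Proof.
have mkseq_ord (h : nat -> T) : mkseq h n = [tuple h i | i < n].
  by rewrite /mkseq -val_enum_ord -map_comp.
rewrite (mkseq_ord g) => /tuple_permP[s def_f]; exists s => i.
have: nth (f i) (mkseq f n) i = g (s i).
  by rewrite def_f -tnth_nth !tnth_mktuple.
by rewrite nth_mkseq.
Qed.

(** * Products of cyclic subgroups *)

Lemma quotient_prod_cycles (gT : finGroupType) (N : {group gT}) (s : seq gT) :
    {in s, forall a, a \in 'N(N)} ->
  (\prod_(a <- s) <[a]>) / N = \prod_(a <- s) <[coset N a]>.
Proof.
elim: s => [|a s IHs] nNs; first by rewrite !big_nil; apply: quotient1.
rewrite !big_cons quotientMl ?cycle_subG ?nNs ?mem_head //.
by rewrite IHs ?quotient_cycle ?nNs ?mem_head // => b sb; rewrite nNs // mem_behead.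
Qed.

Lemma card_prod_cycles_leq (gT : finGroupType) (s : seq gT) :
  #|\prod_(a <- s) <[a]>| <= \prod_(a <- s) #[a].
Proof.
elim: s => [|a s IHs]; first by rewrite !big_nil cards1.
rewrite !big_cons; apply: leq_trans (leq_mul (leqnn _) IHs).
rewrite -[#[a]]/#|<[a]>| -cardsX.
apply: leq_trans (leq_imset_card (fun z => z.1 * z.2) _); apply: subset_leq_card.
apply/subsetP=> _ /mulsgP[x y Ax By ->]; apply/imsetP.
by exists (x, y); rewrite // in_setX Ax.
Qed.

Lemma mem_prod_cycles (gT : finGroupType) (s : seq gT) :
  {subset s <= \prod_(a <- s) <[a]>}.
Proof.
have P1 (r : seq gT) : 1 \in \prod_(a <- r) <[a]>.
  elim: r => [|b r IHr]; rewrite ?big_nil ?set11 // big_cons.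
  by have := mem_mulg (group1 <[b]>) IHr; rewrite mulg1.
elim: s => // b s IHs a; rewrite inE big_cons => /predU1P[-> | /IHs sa].
  by have := mem_mulg (cycle_id b) (P1 s); rewrite mulg1.
by have := mem_mulg (group1 <[b]>) sa; rewrite mul1g.
Qed.

Lemma prod_cycles_sub (gT : finGroupType) (G : {group gT}) (s : seq gT) :
  {subset s <= G} -> \prod_(a <- s) <[a]> \subset G.
Proof.
elim: s => [|a s IHs] sG; first by rewrite big_nil sub1G.
rewrite big_cons mul_subG ?cycle_subG ?sG ?mem_head // IHs // => b sb.
by rewrite sG // mem_behead.
Qed.

(** * Sections and their isomorphisms *)

(* R is the set of pairs (x, x') such that the class of x in B / A is mapped to
   that of x' in B' / A' by an algebra isomorphism; the last clause is the
   compatibility with the product.  Boolean, so that the sections isomorphic to a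
   given one form a finite set, used as the label of its isomorphism class. *)
Definition section_graph p (aT rT : finGroupType) (B A : {set aT}) (B' A' : {set rT})
    (R : {set aT * rT}) : bool :=
  [&& R \subset setX B B', B \subset fst @: R, B' \subset snd @: R,
      setX A A' \subset R, [forall u in R, (u.1 \in A) == (u.2 \in A')]
    & commg_set R R \subset ppowers p R].

Definition section_iso p (aT rT : finGroupType) (B A : {set aT}) (B' A' : {set rT}) : bool :=
  [exists R : {group aT * rT}, section_graph p B A B' A' R].

(** Powerful embedding on bare commutators and bare p-th powers, without generated subgroups. Inside
    a group of class P the p-th powers of a subgroup already form a subgroup, so nothing is lost
    there. *)
Definition pembed p (gT : finGroupType) (A B : {set gT}) : bool :=
  commg_set A B \subset ppowers p A.

Lemma pembedP p (gT : finGroupType) (A B : {set gT}) :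
  reflect {in A & B, forall x y, [~ x, y] \in ppowers p A} (pembed p A B).
Proof.
apply: (iffP subsetP) => [sAB x y Ax By | sAB _ /imset2P[x y Ax By ->]].
  by rewrite sAB ?imset2_f.
exact: sAB.
Qed.

Lemma pembedS p (gT : finGroupType) (A B C : {set gT}) :
  C \subset B -> pembed p A B -> pembed p A C.
Proof. by move=> sCB; apply: subset_trans; apply: imset2Sr. Qed.
(** * An abstract Jordan-Hoelder theorem *)

Section JordanHolder.

Variables (T L : eqType) (mx : T -> T -> Prop) (bot : T) (lab : T -> T -> L).

Definition mx_series n (d : nat -> T) : Prop :=
  d 0 = bot /\ forall i, i < n -> mx (d i) (d i.+1).

Definition mx_factors n (d : nat -> T) : seq L :=
  mkseq (fun i => lab (d i.+1) (d i)) n.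

Hypothesis mx_bot : forall A, ~ mx A bot.
Hypothesis mx_diamond : forall A A' B, mx A B -> mx A' B -> A <> A' ->
  exists D, [/\ mx D A, mx D A', lab B A = lab A' D & lab B A' = lab A D].
Hypothesis mx_series_exists : forall A B, mx A B ->
  exists n d, mx_series n d /\ d n = A.

Lemma mx_factorsS n d : mx_factors n.+1 d = rcons (mx_factors n d) (lab (d n.+1) (d n)).
Proof. exact: mkseqS. Qed.

Lemma mx_series_extend n d A : mx_series n d -> mx (d n) A ->
  exists e, [/\ mx_series n.+1 e, e n.+1 = A
              & mx_factors n.+1 e = rcons (mx_factors n d) (lab A (d n))].
Proof.
move=> [d0 ser_d] mxA; pose e i := if i <= n then d i else A.
exists e; split.
- split=> [|i]; rewrite ?/e ?leq0n // ltnS => le_in; rewrite le_in.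
  by case: ltnP => [/ser_d // | le_ni]; have /eqP -> : i == n by rewrite eqn_leq le_in.
- by rewrite /e ltnn.
rewrite mx_factorsS /e ltnn leqnn; congr (rcons _ _).
apply/eq_in_map=> i; rewrite mem_iota /= => lt_in.
by rewrite lt_in ltnW.
Qed.

Lemma mx_jordan_holder n m H K :
    mx_series n H -> mx_series m K -> H n = K m ->
  n = m /\ perm_eq (mx_factors n H) (mx_factors m K).
Proof.
elim: n m H K => [|n IHn] [|m] H K serH serK eqHK; first by split.
- case: serH serK => H0 _ [_ /(_ m (ltnSn m))].
  by rewrite -eqHK H0 => /mx_bot.
- case: serK serH => K0 _ [_ /(_ n (ltnSn n))].
  by rewrite eqHK K0 => /mx_bot.
have mxH : mx (H n) (H n.+1) by case: serH => _; apply.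
have mxK : mx (K m) (K m.+1) by case: serK => _; apply.
have serHn : mx_series n H by case: serH => H0 sH; split=> // i /ltnW; apply: sH.
have serKm : mx_series m K by case: serK => K0 sK; split=> // i /ltnW; apply: sK.
rewrite !mx_factorsS; have [eqHKn | /eqP neqHK] := eqVneq (H n) (K m).
  have [def_m eqF] := IHn m H K serHn serKm eqHKn.
  by split; [rewrite def_m | rewrite eqHK eqHKn -!cats1 perm_cat2r].
(* One series [d] of D is extended to a series [e] of [H n] and a series [f] of [K m]; by the
   diamond, completing either of them to the top gives the same two last labels, swapped. *)
have [|D [DH DK labH labK]] := mx_diamond mxH _ neqHK; first by rewrite eqHK.
have [k [d [ser_d dk]]] := mx_series_exists DH; rewrite -dk in DH DK labH labK.
have [e [ser_e eH Fe]] := mx_series_extend ser_d DH.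
have [f [ser_f fK Ff]] := mx_series_extend ser_d DK.
have [def_k permH] := IHn _ _ _ serHn ser_e (esym eH).
(* The comparison with [e] forces [n = k.+1]; hence [f] has length [n] too, and the induction
   hypothesis applies to it. *)
rewrite -def_k in ser_f fK Ff permH Fe.
have [def_m permK] := IHn _ _ _ ser_f serKm fK.
split; first by rewrite def_m.
apply/seq.permP=> P; rewrite labH -eqHK labK -!cats1 !count_cat.
rewrite (seq.permP permH) -(seq.permP permK) Fe Ff -!cats1 !count_cat.
exact: addnAC.
Qed.

End JordanHolder.

Section OddPrime.

Variable p : nat.
Hypotheses (p_pr : prime p) (p_odd : odd p).

(** * Groups of type (2,...,2) *)

(** Collection leaves the factor [x, y]^C(p,2). Oddness of p enters here: p divides C(p,2), so this
    factor is trivial. *)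
Lemma pexpgM (gT : finGroupType) (x y : gT) :
    commute x [~ x, y] -> commute y [~ x, y] -> [~ x, y] ^+ p = 1 ->
  (y * x) ^+ p = y ^+ p * x ^+ p.
Proof.
move=> cx cy e1; rewrite expMg_Rmul //.
have /dvdnP[k ->]: p %| 'C(p, 2).
  by apply: prime_dvd_bin => //=; apply: odd_prime_gt2.
by rewrite mulnC expgM e1 expg1n mulg1.
Qed.

Section CentralPowers.

Variables (gT : finGroupType) (G : {group gT}).
Hypothesis sG'U : [~: G, G] \subset pow_subgroup p 1 G.
Hypothesis cU : {in G &, forall x y, commute (x ^+ p) y}.
Hypothesis eU : {in G, forall x, x ^+ p ^+ p = 1}.

(** Central elements with p-th power 1 form a group, so both properties pass from the p-th powers to
    the subgroup that they generate. *)
Lemma pow_subgroup_central u : u \in pow_subgroup p 1 G ->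
  u \in 'Z(G) /\ u ^+ p = 1.
Proof.
pose A := [set u in 'Z(G) | u ^+ p == 1].
have gA: group_set A.
  apply/group_setP; split=> [|x y]; first by rewrite inE group1 expg1n eqxx.
  case/setIdP=> Zx /eqP ex /setIdP[Zy /eqP ey]; apply/setIdP.
  rewrite groupM // expgMn ?ex ?ey ?mulg1 //.
  by apply: (center_commute Zx); case/setIP: Zy.
have sUA: pow_subgroup p 1 G \subset Group gA.
  rewrite pow_subgroup1 gen_subG; apply/subsetP=> _ /imsetP[x Gx ->].
  apply/setIdP; rewrite eU //; split=> //; rewrite inE groupX //=.
  by apply/centP=> y Gy; apply: cU.
by move/(subsetP sUA)/setIdP=> [-> /eqP].
Qed.

Lemma pow_subgroup_ppowers : pow_subgroup p 1 G = ppowers p G.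
Proof.
apply/eqP; rewrite eqEsubset pow_subgroup1 subset_gen andbT.
have gW: group_set (ppowers p G).
  apply/group_setP; split=> [|_ _ /imsetP[x Gx ->] /imsetP[y Gy ->]].
    by apply/imsetP; exists 1; rewrite ?group1 ?expg1n.
  have [|Zu eu] := @pow_subgroup_central [~ y, x].
    by rewrite (subsetP sG'U) // mem_commg.
  have cu z : z \in G -> commute z [~ y, x].
    by move=> Gz; apply/commute_sym/(center_commute Zu).
  by rewrite -pexpgM ?mem_ppowers ?groupM //; apply: cu.
by rewrite (gen_subG _ (Group gW)).
Qed.

End CentralPowers.

(* By induction modulo a central subgroup M of order p, [G^p, G] and the p-th
   powers of G^p lie in M.  Then x -> x^(p^2) is a morphism, trivial on the
   generators, so that G^p has exponent p, and [x^p, g] = [x, g]^p = 1. *)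
Lemma powerful_ppowers_central (n : nat) (gT : finGroupType) (G : {group gT})
    (S : {set gT}) :
    #|G| <= n -> p.-group G -> [~: G, G] \subset pow_subgroup p 1 G ->
    <<S>> = G -> {in S, forall a, a ^+ p ^+ p = 1} ->
  {in G &, forall x y, commute (x ^+ p) y} /\ {in G, forall x, x ^+ p ^+ p = 1}.
Proof.
elim: n gT G S => [|n IHn] gT G S leGn pG pwG defG eS.
  by rewrite leqNgt cardG_gt0 in leGn.
have [G1 | ntG] := eqVneq (G : {set gT}) 1.
  rewrite G1; split=> [x y /set1P-> _ | x /set1P->]; rewrite ?expg1n //.
  exact/commute_sym/commute1.
have ntZ: 'Z(G) != 1 by rewrite (center_nil_eq1 (pgroup_nil pG)).
have pZ: p.-group 'Z(G) := pgroupS (center_sub G) pG.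
have [_ pdZ _] := pgroup_pdiv pZ ntZ.
have [z Zz oz] := Cauchy p_pr pdZ.
set M := <[z]>%G.
have sMZ: M \subset 'Z(G) by rewrite cycle_subG.
have cM m : m \in M -> {in G, forall y, commute y m}.
  by move=> /(subsetP sMZ) Zm y Gy; apply/commute_sym/(center_commute Zm).
have eM m : m \in M -> m ^+ p = 1.
  by move=> Mm; apply/eqP; rewrite -order_dvdn -oz; apply: order_dvdG.
have nMG: M <| G := sub_center_normal sMZ.
have nMGx x : x \in G -> x \in 'N(M) by apply: (subsetP (normal_norm nMG)).
have sSG: S \subset G by rewrite -defG subset_gen.
have sUG: pow_subgroup p 1 G \subset G.
  by rewrite pow_subgroup1 gen_subG; apply/subsetP=> _ /imsetP[x Gx ->]; apply: groupX.
have sUGM: pow_subgroup p 1 G / M \subset pow_subgroup p 1 (G / M).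
  rewrite [in X in X \subset _]pow_subgroup1 quotient_gen; last first.
    by apply/subsetP=> _ /imsetP[x Gx ->]; apply/nMGx/groupX.
  rewrite pow_subgroup1; apply: genS.
  apply/subsetP=> _ /morphimP[_ _ /imsetP[x Gx ->] ->].
  by rewrite morphX ?nMGx //; apply/mem_ppowers/mem_quotient.
have pwGM: [~: G / M, G / M] \subset pow_subgroup p 1 (G / M)%G.
  by rewrite -quotientR ?normal_norm //; apply: subset_trans sUGM; apply: quotientS.
have ltGM: #|G / M| <= n.
  rewrite -ltnS; apply: leq_trans leGn; apply: ltn_quotient.
    by rewrite -cardG_gt1 [#|_|]oz prime_gt1.
  exact: normal_sub.
have genSM: <<S / M>> = (G / M)%G.
  by rewrite /= -defG quotient_gen // (subset_trans sSG (normal_norm nMG)).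
have eSM: {in S / M, forall a, a ^+ p ^+ p = 1}.
  move=> _ /morphimP[a _ Sa ->]; have Ga := subsetP sSG a Sa.
  by rewrite -!morphX ?groupX ?nMGx // eS // morph1.
have [cGM eGM] := IHn _ _ _ ltGM (quotient_pgroup M pG) pwGM genSM eSM.
have UM u : u \in pow_subgroup p 1 G ->
  {in G, forall y, [~ u, y] \in M} /\ u ^+ p \in M.
  move=> Uu; have Gu := subsetP sUG u Uu.
  have [|ZMu eMu] := @pow_subgroup_central _ (G / M)%G cGM eGM (coset M u).
    by rewrite (subsetP sUGM) // mem_quotient.
  split=> [y Gy|]; apply: coset_idr; rewrite ?groupR ?groupX ?nMGx //; last by rewrite morphX ?nMGx.
  rewrite morphR ?nMGx //; apply/eqP/commgP.
  by apply: (center_commute ZMu); apply: mem_quotient.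
have Uc x y : x \in G -> y \in G -> [~ x, y] \in pow_subgroup p 1 G.
  by move=> Gx Gy; rewrite (subsetP pwG) ?mem_commg.
have Up x : x \in G -> x ^+ p \in pow_subgroup p 1 G.
  by move=> Gx; rewrite pow_subgroup1 mem_gen ?mem_ppowers.
have pM x y : x \in G -> y \in G -> [~ x, y] \in M -> (y * x) ^+ p = y ^+ p * x ^+ p.
  by move=> Gx Gy Mxy; apply: pexpgM (eM _ Mxy); apply: (cM _ Mxy).
have exp2 : {in G, forall x, x ^+ p ^+ p = 1}.
  pose E := [set x in G | x ^+ p ^+ p == 1].
  have gE: group_set E.
    apply/group_setP; split=> [|y x]; first by rewrite inE group1 !expg1n eqxx.
    rewrite !inE => /andP[Gy /eqP ey] /andP[Gx /eqP ex]; rewrite groupM //=.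
    (* Modulo M the induction makes x -> x^p multiplicative. The correcting factor m in M is central
       with m^p = 1, so the second p-th power removes it. *)
    have: coset M ((y * x) ^+ p) = coset M (y ^+ p * x ^+ p).
      have [|ZMu eMu] := @pow_subgroup_central _ (G / M)%G cGM eGM [~ coset M x, coset M y].
        by rewrite (subsetP pwGM) // mem_commg ?mem_quotient.
      have cZ w : w \in G -> commute (coset M w) [~ coset M x, coset M y].
        by move=> Gw; apply/commute_sym/(center_commute ZMu)/mem_quotient.
      rewrite morphX ?morphM ?groupX ?nMGx ?groupM //.
      by rewrite pexpgM ?(morphX (coset M)) ?nMGx //; apply: cZ.
    have [G1' G2']: (y * x) ^+ p \in G /\ y ^+ p * x ^+ p \in G.
      by split; rewrite ?groupX ?groupM ?groupX.
    case/(@rcoset_kercosetP _ M _ _ (nMGx _ G1') (nMGx _ G2'))/rcosetP=> m Mm ->.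
    rewrite expgMn; last by apply/commute_sym; apply: cM.
    have Mxy: [~ x ^+ p, y ^+ p] \in M.
      by have [-> //] := UM _ (Up x Gx); apply: groupX.
    by rewrite (eM _ Mm) mul1g pM ?groupX // ex ey mulg1.
  have sGE: G \subset Group gE.
    by rewrite -defG gen_subG; apply/subsetP=> a Sa; rewrite inE (subsetP sSG) //= eS.
  by move=> x /(subsetP sGE); rewrite inE => /andP[_ /eqP].
have expU u : u \in pow_subgroup p 1 G -> u ^+ p = 1.
  (* The generators a^p of G^p lie in E by [exp2], and E is closed under products because [G^p, G]
     lies in M, where [pM] applies. *)
  pose E := [set u in pow_subgroup p 1 G | u ^+ p == 1].
  have gE: group_set E.
    apply/group_setP; split=> [|y x]; first by rewrite inE group1 expg1n eqxx.
    rewrite !inE => /andP[Uy /eqP ey] /andP[Ux /eqP ex]; rewrite groupM //=.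
    rewrite pM ?(subsetP sUG) //; first by rewrite ex ey mulg1.
    by have [->] := UM x Ux; rewrite ?(subsetP sUG).
  have sUE: pow_subgroup p 1 G \subset Group gE.
    rewrite [in X in X \subset _]pow_subgroup1 gen_subG.
    by apply/subsetP=> _ /imsetP[a Ga ->]; rewrite inE Up //= exp2.
  by move/(subsetP sUE); rewrite inE => /andP[_ /eqP].
split=> // x g Gx Gg; apply/commgP/conjg_fixP.
have Mcx: [~ [~ x, g], x] \in M by have [-> //] := UM _ (Uc x g Gx Gg).
by rewrite conjXg conjg_mulR pM // ?groupR // (expU _ (Uc x g Gx Gg)) mulg1.
Qed.

Section Hclass2Theory.

Variables (gT : finGroupType) (Q : {group gT}).
Hypothesis hQ : hclass2 p Q.

Lemma hclass2_comm_central : {in Q & &, forall x y z, commute [~ x, y] z}.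
Proof.
move=> x y z Qx Qy Qz; have /imsetP[w Qw ->] := hclass2_comm hQ Qx Qy.
exact: (hclass2_central hQ).
Qed.

Lemma hclass2_comm_exp : {in Q &, forall x y, [~ x, y] ^+ p = 1}.
Proof.
move=> x y Qx Qy; have /imsetP[w Qw ->] := hclass2_comm hQ Qx Qy.
exact: (hclass2_exp hQ).
Qed.

Lemma hclass2_expM : {in Q &, {morph (fun x => x ^+ p) : x y / x * y}}.
Proof.
move=> x y Qx Qy; apply: (pexpgM); last exact: hclass2_comm_exp.
  exact/commute_sym/hclass2_comm_central.
exact/commute_sym/hclass2_comm_central.
Qed.

Definition pexp_morphism := Morphism hclass2_expM.

Lemma hclass2_commMl : {in Q & &, forall x y z, [~ x * y, z] = [~ x, z] * [~ y, z]}.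
Proof.
move=> x y z Qx Qy Qz; rewrite commMgJ; congr (_ * _).
by apply/conjg_fixP/commgP/hclass2_comm_central.
Qed.

Lemma hclass2_commMr : {in Q & &, forall x y z, [~ x, y * z] = [~ x, y] * [~ x, z]}.
Proof.
move=> x y z Qx Qy Qz; rewrite -invg_comm hclass2_commMl // invMg !invg_comm.
by apply: hclass2_comm_central; rewrite ?groupR.
Qed.

Lemma group_set_ppowers (A : {group gT}) : A \subset Q -> group_set (ppowers p A).
Proof.
by move=> sAQ; rewrite -[ppowers p A](morphimEsub pexp_morphism sAQ) groupP.
Qed.

Lemma ppowersE (A : {group gT}) : A \subset Q -> pow_subgroup p 1 A = ppowers p A.
Proof.
by move=> sAQ; rewrite pow_subgroup1 -[RHS](genGid (Group (group_set_ppowers sAQ))).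
Qed.

Lemma ppowersP x : reflect (x \in Q /\ x ^+ p = 1) (x \in ppowers p Q).
Proof.
apply: (iffP idP) => [/imsetP[y Qy ->] | [Qx]]; last exact: (hclass2_Ohm hQ).
by rewrite groupX ?(hclass2_exp hQ).
Qed.

(** The morphism x -> x^p has Q^p both as kernel and as image. *)
Lemma card_hclass2 : #|Q| = (#|ppowers p Q| * #|ppowers p Q|)%N.
Proof.
have kerQ: 'ker pexp_morphism = ppowers p Q.
  apply/setP=> x; apply/idP/ppowersP=> [Kx | [Qx ex]].
    by split; [exact: dom_ker Kx | exact: (mker Kx)].
  exact/kerP.
have sKQ: 'ker pexp_morphism \subset Q := subsetIl _ _.
rewrite -{1}(Lagrange sKQ) /= kerQ; congr (_ * _)%N.
have imQ: pexp_morphism @* Q = ppowers p Q by rewrite morphimEsub.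
by rewrite -[in RHS]imQ card_morphim setIid /= kerQ.
Qed.

Lemma ppowers_normal : pow_subgroup p 1 Q <| Q.
Proof.
apply: sub_center_normal; rewrite /= ppowersE //; apply/subsetP=> _ /imsetP[x Qx ->].
by rewrite inE groupX //; apply/centP=> y Qy; apply: (hclass2_central hQ).
Qed.

Lemma card_quotient_hclass2 : #|Q / pow_subgroup p 1 Q| = #|ppowers p Q|.
Proof.
have [sZQ nZQ] := andP ppowers_normal.
rewrite card_quotient //; apply/eqP.
rewrite -(eqn_pmul2l (cardG_gt0 (pow_subgroup p 1 Q))) Lagrange //.
by rewrite /= ppowersE // card_hclass2.
Qed.

Lemma quotient_hclass2_abelem : p.-abelem (Q / pow_subgroup p 1 Q).
Proof.
have [sZQ nZQ] := andP ppowers_normal.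
apply/abelemP=> //; split.
  apply: sub_der1_abelian; rewrite gen_subG /= ppowersE //.
  by apply/subsetP=> _ /imset2P[x y Qx Qy ->]; apply: (hclass2_comm hQ).
move=> _ /morphimP[x Nx Qx ->]; rewrite -morphX //.
by apply: coset_id; rewrite /= ppowersE // mem_ppowers.
Qed.

Lemma hclass2_order x : x \in Q -> x \notin ppowers p Q -> #[x] = (p ^ 2)%N.
Proof.
move=> Qx; apply: contraNeq => ox.
have: (#[x] %| p ^ 2)%N by rewrite order_dvdn expnS expn1 expgM (hclass2_exp hQ).
case/(dvdn_pfactor _ 2 p_pr) => [[|[|[|//]]]] _ ox1; last by rewrite ox1 eqxx in ox.
  by move/eqP: ox1; rewrite order_eq1 => /eqP->; apply/imsetP; exists 1; rewrite ?expg1n.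
by apply/ppowersP; split=> //; apply/eqP; rewrite -order_dvdn ox1.
Qed.

End Hclass2Theory.

(** Since x -> x^p is multiplicative with central values, x^p can be distributed over the cyclic
    factors of u. The product set is not yet known to be a subgroup, but it absorbs the p-th powers
    of its own elements. *)
Lemma prod_cycles_absorb (gT : finGroupType) (Q : {group gT}) (s : seq gT) u x :
    hclass2 p Q -> {subset s <= Q} ->
    u \in \prod_(a <- s) <[a]> -> x \in \prod_(a <- s) <[a]> ->
  [/\ u \in Q, x \in Q & u * x ^+ p \in \prod_(a <- s) <[a]>].
Proof.
move=> hQ; elim: s u x => [|a s IHs] u x sQ.
  by rewrite !big_nil => /set1P-> /set1P->; rewrite expg1n mulg1 group1 set11.
rewrite !big_cons => /mulsgP[_ u' /cycleP[i ->] Pu' ->] /mulsgP[_ x' /cycleP[j ->] Px' ->].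
have Qa: a \in Q by rewrite sQ ?mem_head.
have [|Qu Qx P1] := IHs u' x' _ Pu' Px'; first by move=> b sb; rewrite sQ // mem_behead.
split; rewrite ?groupM ?groupX //.
rewrite (hclass2_expM hQ) ?groupX // mulgA -(mulgA _ u').
have cx: commute (a ^+ j ^+ p) u' by apply: (hclass2_central hQ); rewrite ?groupX.
by rewrite -cx !mulgA -mulgA mem_mulg // groupM ?groupX // cycle_id.
Qed.

(** [hclass2_Ohm] comes from counting. With r basis elements |Q| = p^(2r), while Q / Q^p is a
    product of r cyclic groups of order at most p, so |Q^p| is at least p^r. As Q^p lies in the
    kernel of x -> x^p and |Q| = |ker| |Q^p|, the kernel must equal Q^p. *)
Lemma classP_hclass2 (gT : finGroupType) (Q : {group gT}) :
  classP p Q -> hclass2 p Q.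
Proof.
case=> [[pQ pwQ] [s [[defQ oQ] os]]].
have sQ: {subset s <= Q} by rewrite -defQ; apply: mem_prod_cycles.
have genS: <<[set a in s]>> = Q.
  apply/eqP; rewrite eqEsubset; apply/andP; split.
    by rewrite gen_subG; apply/subsetP=> a; rewrite inE => /sQ.
  by rewrite -defQ prod_cycles_sub // => a sa; rewrite mem_gen ?inE.
have eS: {in [set a in s], forall a, a ^+ p ^+ p = 1}.
  by move=> a; rewrite inE => /os oa; rewrite -expgM -[(p * p)%N]/(p ^ 2)%N -oa expg_order.
have [cW eW] := powerful_ppowers_central (leqnn _) pQ pwQ genS eS.
have defW := pow_subgroup_ppowers pwQ cW eW.
have sWZ : pow_subgroup p 1 Q \subset 'Z(Q).
  by apply/subsetP=> w /(pow_subgroup_central cW eW) [].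
have nsWQ := sub_center_normal sWZ; have [/= sWQ nWQ] := andP nsWQ.
have expM: {in Q &, {morph (fun x => x ^+ p) : x y / x * y}}.
  move=> x y Qx Qy; have [|Zc ec] := pow_subgroup_central cW eW (u := [~ y, x]).
    by rewrite (subsetP pwQ) ?mem_commg.
  by apply: pexpgM => //; apply/commute_sym/(center_commute Zc).
pose f := Morphism expM.
have imf: f @* Q = ppowers p Q by rewrite morphimEsub.
have oQW: #|Q| = (#|ppowers p Q| * #|Q / pow_subgroup p 1 Q|)%N.
  by rewrite card_quotient // -defW Lagrange.
have oQK: #|Q| = (#|'ker f| * #|ppowers p Q|)%N.
  by rewrite -imf card_morphim setIid Lagrange // subsetIl.
have oQs: #|Q| = (p ^ size s * p ^ size s)%N.
  rewrite oQ (eq_big_seq (fun=> p ^ 2)%N os) big_const_seq count_predT iter_muln_1.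
  by rewrite -expnM mulnC expnM expnS expn1.
have leQW: #|Q / pow_subgroup p 1 Q| <= p ^ size s.
  rewrite -[in X in X / _]defQ quotient_prod_cycles; last first.
    by move=> a /sQ Qa; apply: (subsetP nWQ).
  have -> : \prod_(a <- s) <[coset (pow_subgroup p 1 Q) a]>
      = \prod_(b <- map (coset (pow_subgroup p 1 Q)) s) <[b]> by rewrite big_map.
  apply: leq_trans (card_prod_cycles_leq _) _; rewrite big_map.
  elim: s sQ {defQ oQ os genS eS oQs} => [|a s IHs] sQ; first by rewrite big_nil.
  rewrite big_cons expnS leq_mul ?IHs //; last first.
    by move=> b sb; rewrite sQ // mem_behead.
  rewrite dvdn_leq ?prime_gt0 // order_dvdn.
  have Qa : a \in Q by rewrite sQ ?mem_head.
  rewrite -morphX ?(subsetP nWQ) //; apply/eqP/coset_id.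
  by rewrite /= defW mem_ppowers.
have lePW: p ^ size s <= #|ppowers p Q|.
  rewrite -(@leq_pmul2r (p ^ size s)) ?expn_gt0 ?prime_gt0 //.
  by rewrite -oQs oQW leq_mul.
have sWK: ppowers p Q \subset 'ker f.
  apply/subsetP=> _ /imsetP[x Qx ->]; apply/kerP; rewrite ?groupX //.
  exact: eW.
have eqWK: ppowers p Q = 'ker f.
  apply/eqP; rewrite eqEcard sWK -(@leq_pmul2r #|ppowers p Q|); last first.
    by rewrite (leq_trans _ lePW) ?expn_gt0 ?prime_gt0.
  by rewrite -oQK oQs leq_mul.
split=> // [x y Qx Qy | x Qx ex].
  by rewrite -defW (subsetP pwQ) // mem_commg.
by rewrite eqWK; apply/kerP.
Qed.

(** Coset representatives of a basis of the elementary abelian group Q / Q^p form a powerful basis: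
    they lie outside Q^p, so have order p^2, and their number r satisfies |Q| = p^(2r). *)
Lemma hclass2_classP (gT : finGroupType) (Q : {group gT}) :
  hclass2 p Q -> classP p Q.
Proof.
move=> hQ; have defW := ppowersE hQ (subxx Q).
split; first split.
- exact: hclass2_pgroup hQ.
- rewrite gen_subG /= defW.
  by apply/subsetP=> _ /imset2P[x y Qx Qy ->]; apply: (hclass2_comm hQ).
have [sWQ nWQ] := andP (ppowers_normal hQ); rewrite /= in sWQ nWQ.
have abQ := quotient_hclass2_abelem hQ.
have [b defb ob] := abelian_structure (abelem_abelian abQ).
pose W := pow_subgroup_group p 1 Q; pose s := [seq repr (x : coset_of W) | x <- b].
have coset_s: map (coset W) s = b.
  by rewrite -map_comp map_id_in // => x _; apply: coset_reprK.
have Qb: {subset b <= Q / W}.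
  by rewrite -(bigdprodW defb); apply: mem_prod_cycles.
have sQ: {in s, forall a, a \in Q /\ coset W a \in b}.
  move=> _ /mapP[x bx ->]; rewrite coset_reprK; split=> //.
  have /morphimP[y Ny Qy] := Qb x bx => defx.
  have: repr x \in coset W y by rewrite -defx mem_repr_coset.
  rewrite val_coset // => /rcosetP[w Ww ->].
  by rewrite groupM // (subsetP sWQ).
have os: {in s, forall a, #[a] = (p ^ 2)%N}.
  move=> a /sQ[Qa ba]; apply: (hclass2_order hQ Qa).
  apply/negP=> Wa; have := abelian_type_gt1 (Q / W).
  rewrite -ob all_map => /allP/(_ _ ba) /=.
  by rewrite coset_id ?order1 //= defW.
exists s; split=> //; split.
  apply/eqP; rewrite eqEsubset prod_cycles_sub /=; last by move=> a /sQ[].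
  have coverQ q : q \in Q -> exists2 u, u \in \prod_(a <- s) <[a]> &
      exists2 w, w \in Q & q = u * w ^+ p.
    move=> Qq; have: coset W q \in Q / W by rewrite mem_quotient.
    have eqQ: (\prod_(a <- s) <[a]>) / W = Q / W.
      rewrite quotient_prod_cycles; last by move=> a /sQ[Qa _]; rewrite (subsetP nWQ).
      have -> : \prod_(a <- s) <[coset W a]> = \prod_(x <- map (coset W) s) <[x]>.
        by rewrite [RHS]big_map.
      by rewrite coset_s (bigdprodW defb).
    rewrite -eqQ => /morphimP[u Nu Pu eq_qu]; exists u => //.
    have [z Wz ->] := kercoset_rcoset (subsetP nWQ q Qq) Nu eq_qu.
    move: Wz; rewrite /= defW => /imsetP[w Qw ->]; exists w => //.
    apply: (hclass2_central hQ) => //.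
    by move: Pu; apply: (subsetP (prod_cycles_sub _)) => a /sQ[].
  (* In q = u w^p only the class of w modulo Q^p matters, so w may be replaced by an element x of
     the product set, and u x^p is then absorbed. *)
  apply/subsetP=> q /coverQ[u Pu [w Qw ->]].
  have [x Px [w' Qw' defw]] := coverQ w Qw.
  have [|_ Qx Pux] := @prod_cycles_absorb _ Q s u x hQ _ Pu Px; first by move=> a /sQ[].
  by rewrite defw (hclass2_expM hQ) ?groupX // (hclass2_exp hQ) ?mulg1.
have oW: #|ppowers p Q| = (p ^ size s)%N.
  rewrite -(card_quotient_hclass2 hQ) -(bigdprod_card defb) size_map.
  rewrite (eq_big_seq (fun=> p)) ?big_const_seq ?count_predT ?iter_muln_1 // => x bx.
  rewrite -[#|_|]/#[x] (abelem_order_p abQ) ?Qb //.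
  rewrite -order_eq1 gtn_eqF //; have := abelian_type_gt1 (Q / W).
  by rewrite -ob all_map => /allP/(_ _ bx).
rewrite (card_hclass2 hQ) oW (eq_big_seq (fun=> p ^ 2)%N os) big_const_seq.
by rewrite count_predT iter_muln_1 -!expnD -expnM addnn mul2n.
Qed.

(** * Supplements of the p-th powers and lifting *)

Lemma ppowers_mod (gT : finGroupType) (Q T B : {group gT}) :
    hclass2 p Q -> B \subset Q -> T \subset B -> B \subset T * ppowers p Q ->
  ppowers p B = ppowers p T.
Proof.
move=> hQ sBQ sTB sBT; apply/eqP; rewrite eqEsubset [in X in _ && X]ppowersS // andbT.
apply/subsetP=> _ /imsetP[b Bb ->].
have /mulsgP[t _ Tt /imsetP[w Qw ->] ->] := subsetP sBT b Bb.
have Qt : t \in Q by rewrite (subsetP sBQ) ?(subsetP sTB).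
by rewrite (hclass2_expM hQ) ?groupX // (hclass2_exp hQ) // mulg1 mem_ppowers.
Qed.

(* T is a minimal supplement to the p-th powers of Q in B: it has no element of
   order p outside T^p, which contains its Frattini subgroup, since a maximal
   subgroup of T avoiding such an element would be a smaller supplement. *)
Lemma hclass2_lift (gT : finGroupType) (Q B : {group gT}) :
    hclass2 p Q -> B \subset Q ->
    {in B &, forall x y, [~ x, y] \in ppowers p B} ->
  exists T : {group gT}, [/\ T \subset B, B \subset T * ppowers p Q & hclass2 p T].
Proof.
move=> hQ sBQ pwB; have defW := ppowersE hQ (subxx Q).
pose W := pow_subgroup_group p 1 Q.
have defW' : W = ppowers p Q :> {set gT} by [].
pose P (T : {group gT}) := (T \subset B) && (B \subset T * W).
have PB: P B by rewrite /P subxx mulG_subl.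
have [T /mingroupP[/andP[sTB sBT] minT] _] := mingroup_exists PB.
rewrite /= defW in sBT; exists T; split=> //.
have sTQ := subset_trans sTB sBQ; have TQ := subsetP sTQ.
have eqBT := ppowers_mod hQ sBQ sTB sBT.
have pT: p.-group T := pgroupS sTQ (hclass2_pgroup hQ).
have comT: {in T &, forall x y, [~ x, y] \in ppowers p T}.
  by move=> x y Tx Ty; rewrite -eqBT pwB ?(subsetP sTB).
split=> // [x y Tx Ty | x Tx | x Tx ex].
- by apply: (hclass2_central hQ); apply: TQ.
- by apply: (hclass2_exp hQ); apply: TQ.
have defV := ppowersE hQ sTQ; pose V := pow_subgroup_group p 1 T.
rewrite -defV -[pow_subgroup p 1 T]/(gval V); apply: contraT => Vx.
have nVT : T \subset 'N(V).
  apply: subset_trans (cent_sub _); rewrite centsC /= defV.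
  by apply/subsetP=> _ /imsetP[y Ty ->]; apply/centP=> z Tz; apply: (hclass2_central hQ); apply: TQ.
have PhiV : 'Phi(T) \subset V.
  apply: (Phi_min pT nVT); apply/abelemP=> //; split.
    apply: sub_der1_abelian; rewrite gen_subG /= defV.
    by apply/subsetP=> _ /imset2P[y z Ty Tz ->]; apply: comT.
  move=> _ /morphimP[y Ny Ty ->]; rewrite -morphX //.
  by apply: coset_id; rewrite /= defV mem_ppowers.
have : x \notin 'Phi(T) by apply: contra Vx; apply: (subsetP PhiV).
case/bigcapP=> M /maximal_eqP[sMT maxM]; apply: contraT => Mx.
have defT: M <*> <[x]> = T.
  have [| |defM|//] := maxM (M <*> <[x]>)%G; first exact: joing_subl.
    by rewrite join_subG sMT cycle_subG.
  by case/negP: Mx; rewrite -defM mem_gen // inE cycle_id orbT.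
have cWQ: W \subset 'C(Q).
  rewrite defW'; apply/subsetP=> _ /imsetP[y Qy ->]; apply/centP=> z Qz.
  exact: (hclass2_central hQ).
have defMW: M <*> W = M * W.
  by rewrite cent_joinEr // (subset_trans cWQ) ?centS // (subset_trans sMT).
(* Since x^p = 1, x lies in W; as T = <M, x>, passing from T to M loses nothing modulo W. *)
have PM: P M.
  rewrite /P (subset_trans sMT sTB) (subset_trans sBT) // -defW' -defMW.
  rewrite mul_subG ?joing_subr // -defT join_subG joing_subl cycle_subG.
  by rewrite mem_gen // inE defW' (hclass2_Ohm hQ) ?orbT ?TQ.
by rewrite (minT M PM sMT) Tx in Mx.
Qed.

Lemma hclass2_setX (aT rT : finGroupType) (Q : {group aT}) (Q' : {group rT}) :
  hclass2 p Q -> hclass2 p Q' -> hclass2 p (setX_group Q Q').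
Proof.
move=> hQ hQ'; split.
- by rewrite /pgroup cardsX pnatM -!/(pgroup _ _) (hclass2_pgroup hQ) (hclass2_pgroup hQ').
- case=> [x x'] [y y'] /setXP[Qx Qx'] /setXP[Qy Qy'].
  have /imsetP[z Qz def_z] := hclass2_comm hQ Qx Qy.
  have /imsetP[z' Qz' def_z'] := hclass2_comm hQ' Qx' Qy'.
  apply/imsetP; exists (z, z'); rewrite ?in_setX ?Qz // expg_pair -def_z -def_z' //.
- case=> [x x'] [y y'] /setXP[Qx Qx'] /setXP[Qy Qy'].
  rewrite expg_pair; congr (_, _); first exact: (hclass2_central hQ).
  exact: (hclass2_central hQ').
- case=> [x x'] /setXP[Qx Qx'].
  by rewrite !expg_pair (hclass2_exp hQ) // (hclass2_exp hQ').
case=> [x x'] /setXP[Qx Qx']; rewrite expg_pair => -[ex ex'].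
have /imsetP[z Qz ->] := hclass2_Ohm hQ Qx ex.
have /imsetP[z' Qz' ->] := hclass2_Ohm hQ' Qx' ex'.
by rewrite -expg_pair mem_ppowers // in_setX Qz.
Qed.

(** Injectivity: f t = 1 gives t^p = 1, so t = s^p; then f(s)^p = 1 puts f(s) in Q^p, and s^p = 1
    follows. Surjectivity: f(T) covers Q modulo Q^p, so it has the same p-th powers as Q and
    therefore contains Q^p. *)
Lemma hclass2_isog (aT rT : finGroupType) (D T : {group aT}) (Q : {group rT})
    (f : {morphism D >-> rT}) :
    T \subset D -> hclass2 p T -> hclass2 p Q -> f @* T \subset Q ->
    Q \subset f @* T * ppowers p Q ->
    {in T, forall t, f t \in ppowers p Q -> t ^+ p = 1} ->
  T \isog Q.
Proof.
move=> sTD hT hQ sfQ sQf kerf; have TD := subsetP sTD.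
have Qf t : t \in T -> f t \in Q.
  by move=> Tt; rewrite (subsetP sfQ) // mem_morphim ?TD.
have injf: 'injm (restrm sTD f).
  apply/subsetP=> t Kt; apply/set1P.
  have Tt: t \in T := dom_ker Kt.
  have ft1: f t = 1 := mker Kt.
  have /imsetP[s Ts def_t] : t \in ppowers p T.
    by apply: (hclass2_Ohm hT) => //; apply: kerf; rewrite // ft1 ppowers1.
  rewrite def_t kerf //; apply: (hclass2_Ohm hQ); rewrite ?Qf //.
  by rewrite -morphX ?TD // -def_t.
have -> : Q :=: restrm sTD f @* T.
  rewrite restrmEsub //; apply/eqP; rewrite eqEsubset sfQ andbT.
  apply: (subset_trans sQf); rewrite mul_subG //.
  rewrite (ppowers_mod hQ (subxx Q) sfQ sQf); exact: ppowers_sub.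
exact: sub_isog.
Qed.

(** * Calculus of section isomorphisms *)

Lemma section_graphP (aT rT : finGroupType) (B A : {set aT}) (B' A' : {set rT})
    (R : {set aT * rT}) :
  reflect
    [/\ forall x x', (x, x') \in R -> [/\ x \in B, x' \in B' & (x \in A) = (x' \in A')],
        {in B, forall x, exists x', (x, x') \in R},
        {in B', forall x', exists x, (x, x') \in R},
        {in A & A', forall x x', (x, x') \in R}
      & forall x x' y y', (x, x') \in R -> (y, y') \in R ->
          exists z z', [/\ (z, z') \in R, [~ x, y] = z ^+ p & [~ x', y'] = z' ^+ p]]
    (section_graph p B A B' A' R).
Proof.
apply: (iffP and5P) => [[sR sB sB' sA /andP[/forall_inP iA cR]] | [sR sB sB' sA cR]].
  split=> [x x' Rx | x Bx | x' Bx' | x x' Ax Ax' | x x' y y' Rx Ry].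
  - by case/setXP: (subsetP sR _ Rx) => -> ->; split=> //; apply/eqP/(iA _ Rx).
  - by have /imsetP[[z x'] Rzx /= ->] := subsetP sB x Bx; exists x'.
  - by have /imsetP[[x z] Rxz /= ->] := subsetP sB' x' Bx'; exists x.
  - by rewrite (subsetP sA) // in_setX Ax.
  have /imsetP[[z z'] Rz]: [~ (x, x'), (y, y')] \in ppowers p R.
    by rewrite (subsetP cR) // imset2_f.
  rewrite expg_pair => eqz; exists z, z'; split=> //; first exact: (congr1 fst eqz).
  exact: (congr1 snd eqz).
split.
- by apply/subsetP=> -[x x'] /sR[Bx Bx' _]; rewrite in_setX Bx.
- by apply/subsetP=> x /sB[x' Rx]; apply/imsetP; exists (x, x').
- by apply/subsetP=> x' /sB'[x Rx]; apply/imsetP; exists (x, x').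
- by apply/subsetP=> -[x x'] /setXP[Ax Ax']; apply: sA.
apply/andP; split; first by apply/forall_inP=> -[x x'] /sR[_ _ /= ->].
apply/subsetP=> _ /imset2P[[x x'] [y y'] Rx Ry ->].
have [z [z' [Rz def_z def_z']]] := cR _ _ _ _ Rx Ry.
by apply/imsetP; exists (z, z'); rewrite ?expg_pair -?def_z -?def_z'.
Qed.

Lemma section_isoP (aT rT : finGroupType) (B A : {set aT}) (B' A' : {set rT}) :
  reflect (exists R : {group aT * rT}, section_graph p B A B' A' R)
          (section_iso p B A B' A').
Proof. exact: existsP. Qed.

Lemma section_iso_sym (aT rT : finGroupType) (B A : {set aT}) (B' A' : {set rT}) :
  section_iso p B A B' A' -> section_iso p B' A' B A.
Proof.
case/section_isoP=> R /section_graphP[sR sB sB' sA cR].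
pose S := [set u : rT * aT | (u.2, u.1) \in R].
have gS: group_set S.
  apply/group_setP; split=> [|u v]; first by rewrite inE (group1 R).
  by rewrite !inE; apply: (@groupM _ R).
apply/section_isoP; exists (Group gS); apply/section_graphP; split.
- by move=> x' x; rewrite inE => /sR[].
- by move=> x' /sB'[x Rx]; exists x; rewrite inE.
- by move=> x /sB[x' Rx]; exists x'; rewrite inE.
- by move=> x' x Ax' Ax; rewrite inE sA.
move=> x' x y' y; rewrite !inE => /cR h /h[z [z' [Rz def_z def_z']]].
by exists z', z; split; rewrite ?inE.
Qed.

(* If the p-th power map has its kernel in A2 on B2, composing two graphs gives
   a graph: the two choices of a p-th root in B2 differ by an element of A2. *)
Lemma section_iso_trans (T1 T2 T3 : finGroupType) (B1 A1 : {set T1})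
    (B2 : {set T2}) (A2 : {group T2}) (B3 A3 : {set T3}) :
    1 \in A1 -> {in B2 &, forall y z, y ^+ p = z ^+ p -> y^-1 * z \in A2} ->
    section_iso p B1 A1 B2 A2 -> section_iso p B2 A2 B3 A3 ->
  section_iso p B1 A1 B3 A3.
Proof.
move=> A1_1 kerp /section_isoP[R /section_graphP[sR sB sB' sA cR]].
case/section_isoP=> S /section_graphP[tS tB tB' tA cS].
pose C := [set u : T1 * T3 | [exists y, ((u.1, y) \in R) && ((y, u.2) \in S)]].
have CP x z : reflect (exists2 y, (x, y) \in R & (y, z) \in S) ((x, z) \in C).
  by rewrite inE; apply: (iffP existsP) => [[y /andP[]] | [y Rxy Syz]]; exists y => //; apply/andP.
have gC: group_set C.
  apply/group_setP; split=> [|[x z] [x' z']].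
    by apply/CP; exists 1; rewrite ?(group1 R) ?(group1 S).
  case/CP=> y Rxy Syz /CP[y' Rxy' Syz']; apply/CP; exists (y * y').
    exact: (groupM Rxy Rxy').
  exact: (groupM Syz Syz').
apply/section_isoP; exists (Group gC); apply/section_graphP; split.
- by move=> x z /CP[y /sR[Bx _ ->] /tS[_ Bz ->]].
- move=> x /sB[y Rxy]; have [_ /tB[z Syz] _] := sR _ _ Rxy.
  by exists z; apply/CP; exists y.
- move=> z /tB'[y Syz]; have [/sB'[x Rxy] _ _] := tS _ _ Syz.
  by exists x; apply/CP; exists y.
- by move=> x z Ax Az; apply/CP; exists 1; [apply: sA | apply: tA].
move=> x z x' z' /CP[y Rxy Syz] /CP[y' Rxy' Syz'].
have [a [b [Rab -> ab]]] := cR _ _ _ _ Rxy Rxy'.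
have [c [d [Scd bc ->]]] := cS _ _ _ _ Syz Syz'.
exists a, d; split=> //; apply/CP; exists c => //.
have [_ Bb _] := sR _ _ Rab; have [Bc _ _] := tS _ _ Scd.
have Abc: b^-1 * c \in A2 by apply: kerp; rewrite -?ab.
have := groupM Rab (sA _ _ A1_1 Abc).
by rewrite -[_ * _]/(a * 1, b * (b^-1 * c)) mulg1 mulKVg.
Qed.

Lemma hclass2_root (gT : finGroupType) (Q : {group gT}) :
  hclass2 p Q ->
  {in Q &, forall y z, y ^+ p = z ^+ p -> y^-1 * z \in ppowers p Q}.
Proof.
move=> hQ y z Qy Qz eyz; apply: (hclass2_Ohm hQ); first by rewrite groupM ?groupV.
by rewrite (hclass2_expM hQ) ?groupV // expgVn eyz mulVg.
Qed.

(* A graph between Q / Q^p and Q' / Q'^p is a subgroup of Q x Q', and a lift of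
   it is the graph of a group isomorphism. *)
Lemma section_iso_isog (aT rT : finGroupType) (Q : {group aT}) (Q' : {group rT}) :
    hclass2 p Q -> hclass2 p Q' ->
    section_iso p Q (ppowers p Q) Q' (ppowers p Q') ->
  Q \isog Q'.
Proof.
move=> hQ hQ' /section_isoP[R graphR].
have /and3P[sRX _ _] := graphR; case/section_graphP: graphR => sR sB sB' sA cR.
have hX := hclass2_setX hQ hQ'.
have [T [sTR sRT hT]]: exists T : {group aT * rT},
    [/\ T \subset R, R \subset T * ppowers p (setX Q Q') & hclass2 p T].
  apply: (hclass2_lift hX) => // -[x x'] [y y'] Rx Ry.
  have [z [z' [Rz exy exy']]] := cR _ _ _ _ Rx Ry.
  by apply/imsetP; exists (z, z'); rewrite ?expg_pair -?exy -?exy'.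
(* In the graph one coordinate is a p-th power exactly when the other is. This gives the kernel
   condition of [hclass2_isog] for both projections at once. *)
have kerT x x' : (x, x') \in T -> x \in ppowers p Q \/ x' \in ppowers p Q' ->
    (x, x') ^+ p = 1.
  move=> /(subsetP sTR)/sR[_ _ iA] Wx.
  have [Wx1 Wx2]: x \in ppowers p Q /\ x' \in ppowers p Q'.
    by case: Wx => Wx; [rewrite -iA | rewrite iA].
  have /(ppowersP hQ)[_ ex] := Wx1; have /(ppowersP hQ')[_ ex'] := Wx2.
  by rewrite expg_pair ex ex'.
have iso1: T \isog Q.
  apply: (hclass2_isog (f := fst_morphism aT rT)) => //; first exact: subsetT.
  - apply/subsetP=> _ /morphimP[[x x'] _ Tx ->].
    by case: (sR _ _ (subsetP sTR _ Tx)).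
  - apply/subsetP=> x /sB[x' /(subsetP sRT)/mulsgP[t _ Tt /imsetP[[w w'] /setXP[Qw _] ->]]].
    rewrite expg_pair; case: t Tt => t t' Tt /(congr1 fst)/= ->.
    by rewrite mem_mulg ?mem_ppowers //; apply/morphimP; exists (t, t').
  by case=> x x' Tx /= Wx; apply: kerT => //; left.
have iso2: T \isog Q'.
  apply: (hclass2_isog (f := snd_morphism aT rT)) => //; first exact: subsetT.
  - apply/subsetP=> _ /morphimP[[x x'] _ Tx ->].
    by case: (sR _ _ (subsetP sTR _ Tx)).
  - apply/subsetP=> x' /sB'[x /(subsetP sRT)/mulsgP[t _ Tt /imsetP[[w w'] /setXP[_ Qw] ->]]].
    rewrite expg_pair; case: t Tt => t t' Tt /(congr1 snd)/= ->.
    by rewrite mem_mulg ?mem_ppowers //; apply/morphimP; exists (t, t').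
  by case=> x x' Tx /= Wx; apply: kerT => //; right.
by apply: isog_trans iso2; rewrite isog_sym.
Qed.

(** * Ideals between G^p and G *)

Section Ambient.

Variables (gT : finGroupType) (G : {group gT}).
Hypothesis hG : hclass2 p G.
Let Z := pow_subgroup_group p 1 G.
Implicit Types A B D E : {group gT}.

(* A / Z is a maximal proper ideal of the subalgebra B / Z of G / Z. *)
Record maxideal A B : Prop := MaxIdeal {
  maxideal_Z : Z \subset A;
  maxideal_sub : A \subset B;
  maxideal_ambient : B \subset G;
  maxideal_neq : A <> B;
  maxideal_pembed : pembed p A B;
  maxideal_powerful : pembed p B B;
  maxideal_max : forall E, A \subset E -> E \subset B -> pembed p E B ->
                 E = A \/ E = B }.

Let defZ : Z = ppowers p G :> {set gT}.
Proof. exact: (ppowersE hG (subxx G)). Qed.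

Lemma ambient_norm A : Z \subset A -> A \subset G -> G \subset 'N(A).
Proof.
move=> sZA sAG; apply: sub_der1_norm => //; apply: subset_trans sZA.
rewrite gen_subG defZ; apply/subsetP=> _ /imset2P[x y Gx Gy ->].
exact: (hclass2_comm hG).
Qed.

Lemma ambient_mulg A B : Z \subset B -> A \subset G -> B \subset G ->
  A <*> B = A * B.
Proof.
by move=> sZB sAG sBG; rewrite norm_joinEl // (subset_trans sAG) ?ambient_norm.
Qed.

(** Roots of p-th powers are unique modulo Z, hence modulo any subgroup above Z; this is the sense
    in which the product on sections is well defined. *)
Lemma ambient_root B : Z \subset B ->
  {in G &, forall y z, y ^+ p = z ^+ p -> y^-1 * z \in B}.
Proof.
move=> sZB y z Gy Gz eyz; apply: (subsetP sZB).
by rewrite defZ (hclass2_root hG).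
Qed.

(* Here B = A A' and [E A', A A'] = [E, A] [E, A'] [A', A A']. *)
Lemma pembed_joing E A A' B :
    Z \subset A' -> E \subset A -> A \subset B -> A' \subset B -> B \subset G ->
    B \subset A * A' -> pembed p E A -> pembed p A' B ->
  pembed p (E <*> A') B.
Proof.
move=> sZA' sEA sAB sA'B sBG sBA /pembedP pE /pembedP pA'.
have sA'G := subset_trans sA'B sBG; have sAG := subset_trans sAB sBG.
have AG := subsetP sAG; have A'G := subsetP sA'G; have EA := subsetP sEA.
rewrite ambient_mulg ?(subset_trans sEA) //.
apply/pembedP=> _ y /mulsgP[e a Ee A'a ->] By.
have /mulsgP[b c Ab A'c def_y] := subsetP sBA y By.
have [Gb Gc Ge Ga] : [/\ b \in G, c \in G, e \in G & a \in G].
  by split; [apply: AG | apply: A'G | apply/AG/EA | apply: A'G].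
have Gy : y \in G by rewrite (subsetP sBG).
rewrite (hclass2_commMl hG) // {1}def_y (hclass2_commMr hG) //.
have /imsetP[e1 Ee1 ->] := pE e b Ee Ab.
have /imsetP[c1 Ac1 c1E] : [~ c, e] \in ppowers p A'.
  by apply: pA' => //; rewrite (subsetP sAB) ?(subsetP sEA).
have /imsetP[a1 Aa1 ->] := pA' a y A'a By.
rewrite -invg_comm c1E -expgVn -!(hclass2_expM hG) ?groupM ?groupV //;
  try by [apply: A'G | apply: AG; apply: EA].
by rewrite -mulgA mem_ppowers // mem_mulg // groupM ?groupV.
Qed.

(** The second isomorphism theorem for algebras; the graph relates elements congruent modulo A. *)
Lemma section_iso_join A B B1 :
    Z \subset A -> A \subset B -> B \subset G -> B1 \subset B -> B \subset B1 * A ->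
    pembed p A B -> pembed p B B -> pembed p B1 B1 ->
  section_iso p B A B1 (A :&: B1).
Proof.
move=> sZA sAB sBG sB1B sBA /pembedP pA /pembedP pB /pembedP pB1.
have sAG := subset_trans sAB sBG.
have nAB : B \subset 'N(A) by rewrite (subset_trans sBG) ?ambient_norm.
pose R := [set u | [&& u.1 \in B, u.2 \in B1 & u.1^-1 * u.2 \in A]].
have gR: group_set R.
  apply/group_setP; split=> [|[x x'] [y y']].
    by rewrite inE /= !group1 invg1 mulg1 group1.
  rewrite !inE /= => /and3P[Bx Bx' Axx] /and3P[By By' Ayy].
  rewrite (groupM Bx By) (groupM Bx' By') invMg /=.
  have ->: y^-1 * x^-1 * (x' * y') = (x^-1 * x') ^ y * (y^-1 * y').
    by rewrite conjgE !mulgA mulgK.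
  by rewrite groupM // memJ_norm // (subsetP nAB).
apply/section_isoP; exists (Group gR); apply/section_graphP; split.
- move=> x x'; rewrite inE /= => /and3P[Bx Bx' Axx]; split=> //.
  by rewrite inE Bx' andbT -{1}(mulKVg x x') groupMr.
- move=> x Bx; have /mulsgP[b a Bb Aa def_x] := subsetP sBA x Bx.
  by exists b; rewrite inE /= Bx Bb def_x invMg mulgKV groupV.
- by move=> x Bx; exists x; rewrite inE /= (subsetP sB1B) // Bx mulVg group1.
- move=> x x' Ax /setIP[Ax' Bx']; rewrite inE /= (subsetP sAB) // Bx'.
  by rewrite groupM ?groupV.
move=> x x' y y'; rewrite !inE /= => /and3P[Bx Bx' Axx] /and3P[By By' Ayy].
have /imsetP[z Bz def_z] := pB x y Bx By.
have /imsetP[z' Bz' def_z'] := pB1 x' y' Bx' By'.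
exists z, z'; split=> //; rewrite inE /= Bz Bz'.
set a := x^-1 * x' in Axx; set b := y^-1 * y' in Ayy.
have def_x' : x' = x * a by rewrite mulKVg.
have def_y' : y' = y * b by rewrite mulKVg.
have BG := subsetP sBG; have AG := subsetP sAG.
have [Gx Gy Ga Gb] : [/\ x \in G, y \in G, a \in G & b \in G].
  by split; [apply: BG | apply: BG | apply: AG | apply: AG].
have By'' : y' \in B by rewrite (subsetP sB1B).
have /imsetP[c Ac def_c] := pA a y' Axx By''.
have /imsetP[d Ad def_d] := pA b x Ayy Bx.
have [Gz Gz' Gc Gd] : [/\ z \in G, z' \in G, c \in G & d \in G].
  by split; [apply: BG | apply/BG/(subsetP sB1B) | apply: AG | apply: AG].
have Gy' : y' \in G by apply: BG.
(* Bilinearity gives [x a, y b] = [x, y] [x, b] [a, y b], so z d^-1 c is a p-th root of [x', y']. By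
   uniqueness of roots it agrees with z' modulo A, where c and d lie. *)
have ezz: (z * d^-1 * c) ^+ p = z' ^+ p.
  rewrite -def_z' {1}def_x' (hclass2_commMl hG) // def_c def_y'.
  rewrite (hclass2_commMr hG) // -(invg_comm b x) def_d -expgVn def_z.
  by rewrite -!(hclass2_expM hG) // ?groupM ?groupV.
have Gzdc : z * d^-1 * c \in G by rewrite !groupM ?groupV.
have Azz := ambient_root sZA Gzdc Gz' ezz.
have := groupM (groupM (groupVr Ad) Ac) Azz.
by rewrite !invMg invgK !mulgA mulgK mulVg mul1g.
Qed.

Definition section_label B A : {set {group gT} * {group gT}} :=
  [set X : {group gT} * {group gT} | section_iso p B A X.1 X.2].

Lemma ambient_section_iso_trans (T1 T3 : finGroupType) (B1 A1 : {set T1}) A B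
    (B3 A3 : {set T3}) :
    Z \subset A -> B \subset G -> 1 \in A1 ->
    section_iso p B1 A1 B A -> section_iso p B A B3 A3 ->
  section_iso p B1 A1 B3 A3.
Proof.
move=> sZA sBG A1_1; apply: section_iso_trans => // y z By Bz.
by apply: ambient_root; rewrite ?(subsetP sBG).
Qed.

Lemma section_labelP A B A' B' : Z \subset A -> B \subset G ->
    Z \subset A' -> B' \subset G -> section_iso p B A B' A' ->
  section_label B A = section_label B' A'.
Proof.
move=> sZA sBG sZA' sBG' isoBB'; apply/setP=> -[C D]; rewrite !inE /=.
apply/idP/idP; apply: ambient_section_iso_trans; rewrite ?group1 //.
exact: section_iso_sym.
Qed.

Lemma section_iso_refl A B : maxideal A B -> section_iso p B A B A.
Proof.
case=> sZA sAB sBG _ pA pB _; have := section_iso_join sZA sAB sBG (subxx B) _ pA pB pB.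
by rewrite (setIidPl sAB); apply; rewrite mulG_subl.
Qed.

Lemma section_label_iso A B A' B' : maxideal A' B' ->
  section_label B A = section_label B' A' -> section_iso p B A B' A'.
Proof.
move=> mxA' /setP/(_ (B', A')); rewrite !inE /= => ->; exact: section_iso_refl.
Qed.

(** A A' is an ideal of B above A. Were it equal to A, then A' would lie in A, and the maximality of
    A' would leave only A = A' or A = B. *)
Lemma maxideal_join A A' B : maxideal A B -> maxideal A' B -> A <> A' ->
  B :=: A * A'.
Proof.
move=> mxA mxA' neqA; have [sZA sAB sBG neqAB pA pB maxA] := mxA.
have [sZA' sA'B _ neqA'B pA' _ maxA'] := mxA'.
have AA' := ambient_mulg sZA' (subset_trans sAB sBG) (subset_trans sA'B sBG).
rewrite -AA'; apply/esym.
have [||| AA|AB] := maxA (A <*> A')%G; last 1 first.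
- by rewrite -[in RHS]AB.
- exact: joing_subl.
- by rewrite join_subG sAB.
- have sAG := subset_trans sAB sBG.
  apply/pembedP=> x y; rewrite /= AA' => /mulsgP[a a' Aa Aa' ->] By.
  have [Ga Ga' Gy]: [/\ a \in G, a' \in G & y \in G].
    by split; [apply: (subsetP sAG) | apply/(subsetP sBG)/(subsetP sA'B) | apply: (subsetP sBG)].
  rewrite (hclass2_commMl hG) //.
  have /imsetP[c Ac ->] := pembedP _ _ _ pA a y Aa By.
  have /imsetP[c' Ac' ->] := pembedP _ _ _ pA' a' y Aa' By.
  rewrite -(hclass2_expM hG) ?mem_ppowers ?mem_mulg //.
    exact: (subsetP sAG).
  exact/(subsetP sBG)/(subsetP sA'B).
- have sA'A : A' \subset A by rewrite -[in X in _ \subset X]AA joing_subr.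
  by case: (maxA' A sA'A sAB pA) => [/neqA | /neqAB].
Qed.

Lemma maxideal_capl A A' B : maxideal A B -> maxideal A' B -> A <> A' ->
  maxideal (A :&: A') A /\ section_label B A' = section_label A (A :&: A')%G.
Proof.
move=> mxA mxA' neqA; have defB := maxideal_join mxA mxA' neqA.
have [sZA sAB sBG neqAB pA pB maxA] := mxA.
have [sZA' sA'B _ neqA'B pA' _ maxA'] := mxA'.
have sAG := subset_trans sAB sBG; have sA'G := subset_trans sA'B sBG.
have sZD : Z \subset A :&: A' by rewrite subsetI sZA.
have pAA : pembed p A A by apply: pembedS pA.
split; last first.
  apply: section_labelP => //=; rewrite setIC; apply: section_iso_join => //.
  by rewrite defB.
split=> //; first exact: subsetIl.
- move=> defA; have sAA' : A \subset A' by rewrite -defA subsetIr.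
  by case: (maxA A' sAA' sA'B pA') => [/esym/neqA | /neqA'B].
(* The commutator has a p-th root a in A and another a' in A'. They agree modulo Z, which lies in A,
   so a' is a root in the intersection. *)
- apply/pembedP=> x y /setIP[Ax A'x] Ay; have By := subsetP sAB y Ay.
  have /imsetP[a Aa def_xy] := pembedP _ _ _ pA x y Ax By.
  have /imsetP[a' A'a' def_xy'] := pembedP _ _ _ pA' x y A'x By.
  have Aa'' : a^-1 * a' \in A.
    by apply: (ambient_root sZA _ _ (etrans (esym def_xy) def_xy'));
      [apply: (subsetP sAG) | apply: (subsetP sA'G)].
  have Aa' : a' \in A by rewrite -(mulKVg a a') groupM.
  by rewrite def_xy' mem_ppowers // inE Aa' A'a'.
move=> E sDE sEA pE.
(* E A' is an ideal of B above A'. By the modular law, E A' = A' forces E to be the intersection and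
   E A' = B forces E = A. *)
have [||| FA|FB] := maxA' (E <*> A')%G.
- exact: joing_subr.
- by rewrite join_subG sA'B (subset_trans sEA).
- by apply: pembed_joing pE pA'; rewrite // defB.
- left; apply/val_inj/eqP; rewrite eqEsubset /= sDE andbT subsetI sEA.
  by rewrite -[in X in _ \subset X]FA joing_subl.
right; apply/val_inj/eqP; rewrite eqEsubset sEA; apply/subsetP=> a Aa.
have : a \in E <*> A' by rewrite -[E <*> A']/(gval (E <*> A')%G) FB (subsetP sAB).
rewrite ambient_mulg ?(subset_trans sEA) // => /mulsgP[e a' Ee A'a' def_a].
rewrite def_a groupM // (subsetP sDE) // inE A'a' andbT.
by rewrite -(groupMl _ (subsetP sEA e Ee)) -def_a.
Qed.

Lemma maxideal_diamond A A' B : maxideal A B -> maxideal A' B -> A <> A' ->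
  exists D, [/\ maxideal D A, maxideal D A', section_label B A = section_label A' D
              & section_label B A' = section_label A D].
Proof.
move=> mxA mxA' neqA; have [mxD labA'] := maxideal_capl mxA mxA' neqA.
have [] := maxideal_capl mxA' mxA (fun e => neqA (esym e)).
have -> : (A' :&: A = A :&: A')%G by apply: val_inj; apply: setIC.
by exists (A :&: A')%G.
Qed.

Lemma maxideal_series_exists A : Z \subset A -> A \subset G -> pembed p A A ->
  exists n d, mx_series maxideal Z n d /\ d n = A.
Proof.
have [k] := ubnP #|A|; elim: k A => // k IHk A ltAk sZA sAG pA.
have [<- | neqZA] := eqVneq Z A; first by exists 0, (fun=> Z); split.
pose P B := [&& Z \subset B, B \proper A & pembed p B A].
have PZ: P Z.
  rewrite /P subxx properEneq neqZA sZA /=; apply/pembedP=> x y.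
  rewrite {1}defZ => /imsetP[z Gz ->] Ay.
  have -> : [~ z ^+ p, y] = 1.
    apply/eqP/commgP; apply: (hclass2_central hG) => //; exact: (subsetP sAG).
  exact: ppowers1.
have [B /maxgroupP[/and3P[sZB ltBA pB] maxB] _] := maxgroup_exists PZ.
have sBA := proper_sub ltBA.
have mxB : maxideal B A.
  split=> // [eqBA | E sBE sEA pE]; first by rewrite eqBA properxx in ltBA.
  have [ltEA | ] := boolP (E \proper A).
    by left; apply: val_inj; apply: maxB => //; rewrite /P (subset_trans sZB) ?ltEA.
  by rewrite properE sEA negbK /= => sAE; right; apply/val_inj/eqP; rewrite eqEsubset sEA.
have [||||n [d [ser_d dn]]] := IHk B.
- by rewrite -ltnS; apply: leq_trans ltAk; rewrite ltnS proper_card.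
- by [].
- exact: subset_trans sAG.
- exact: pembedS pB.
(* Only the series is wanted here, so the labelling is an arbitrary constant. *)
rewrite -dn in mxB; have [e [ser_e en _]] := mx_series_extend (fun _ _ => 0) ser_d mxB.
by exists n.+1, e.
Qed.

Lemma ambient_central z : z \in Z -> {in G, forall y, commute z y}.
Proof.
by rewrite defZ => /imsetP[x Gx ->] y Gy; apply: (hclass2_central hG).
Qed.

Lemma ambient_Z_sub : Z \subset G.
Proof. by rewrite defZ ppowers_sub. Qed.

Lemma joing_ZP A x : A \subset G -> reflect (exists2 a, a \in A & a^-1 * x \in Z) (x \in A <*> Z).
Proof.
move=> sAG; rewrite ambient_mulg ?ambient_Z_sub //.
apply: (iffP mulsgP) => [[a z Aa Zz ->] | [a Aa Zax]]; first by exists a; rewrite ?mulKg.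
by exists a (a^-1 * x); rewrite ?mulKVg.
Qed.

Lemma ppowers_joing_Z A : A \subset G -> ppowers p (A <*> Z) = ppowers p A.
Proof.
move=> sAG; apply: (ppowers_mod hG) (joing_subl _ _) _.
  by rewrite join_subG sAG ambient_Z_sub.
by rewrite -defZ -ambient_mulg ?ambient_Z_sub.
Qed.

Lemma comm_mod_Z a b x y : a \in G -> b \in G ->
  a^-1 * x \in Z -> b^-1 * y \in Z -> [~ x, y] = [~ a, b].
Proof.
move=> Ga Gb; rewrite -{2}(mulKVg a x) -{2}(mulKVg b y).
move: (a^-1 * x) (b^-1 * y) => z t Zz Zt.
have [Gz Gt] : z \in G /\ t \in G by split; apply: (subsetP ambient_Z_sub).
have com1 u v : u \in Z -> v \in G -> [~ u, v] = 1.
  by move=> Zu Gv; apply/eqP/commgP; apply: ambient_central.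
have Gbt : b * t \in G by apply: groupM.
rewrite (hclass2_commMl hG) // (com1 z) // mulg1.
by rewrite (hclass2_commMr hG) // -(invg_comm t a) (com1 t) // invg1 mulg1.
Qed.

Lemma expp_mod_Z a x : a \in G -> a^-1 * x \in Z -> x ^+ p = a ^+ p.
Proof.
move=> Ga; rewrite -{2}(mulKVg a x) defZ => /(ppowersP hG)[Gz ez].
by rewrite (hclass2_expM hG) // ez mulg1.
Qed.

Lemma pembed_joing_Z A B : A \subset G -> B \subset G -> pembed p A B ->
  pembed p (A <*> Z) (B <*> Z).
Proof.
move=> sAG sBG /pembedP pA; apply/pembedP=> x y.
case/(joing_ZP _ sAG) => a Aa Zx /(joing_ZP _ sBG)[b Bb Zy].
have [Ga Gb] : a \in G /\ b \in G by split; [apply: (subsetP sAG) | apply: (subsetP sBG)].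
by rewrite ppowers_joing_Z // (comm_mod_Z Ga Gb) // pA.
Qed.

(** * Powerfully simple factors as simple sections of G *)

Section Factor.

Variables H H' : {group gT}.
Hypothesis hH' : hclass2 p H'.
Hypothesis sHH' : H \subset H'.
Hypothesis sH'G : H' \subset G.
Hypothesis pH : pembed p H H'.
Hypothesis simpleHH' : powerfully_simple p (H' / H)%G.

Let sHG : H \subset G := subset_trans sHH' sH'G.

Let nHH' : H' \subset 'N(H).
Proof.
apply/subsetP=> x H'x; rewrite inE; apply/subsetP=> _ /imsetP[h Hh ->].
rewrite conjg_mulR groupM // (subsetP (ppowers_sub p _)) //.
exact: (pembedP _ _ _ pH).
Qed.

Let hQ : hclass2 p (H' / H)%G.
Proof. by case: simpleHH' => /(classP_hclass2). Qed.

(** The type (2,...,2) of H' is what counts: an element of G^p has p-th power 1, so once in H' it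
    already has a p-th root in H'. *)
Let Z_root z : z \in Z -> z \in H' -> z \in ppowers p H'.
Proof.
rewrite defZ => /(ppowersP hG)[_ ez] H'z.
exact: (hclass2_Ohm hH').
Qed.

Let powZ w : w \in H' -> w ^+ p \in Z.
Proof. by move=> H'w; rewrite defZ mem_ppowers // (subsetP sH'G). Qed.

Let cosetX w : w \in H' -> coset H (w ^+ p) = coset H w ^+ p.
Proof. by move=> H'w; rewrite morphX // (subsetP nHH'). Qed.

Lemma coset_ppowers x : x \in H' ->
  (coset H x \in ppowers p (H' / H)) = (x \in H <*> Z).
Proof.
move=> H'x; have Nx := subsetP nHH' x H'x; apply/imsetP/(joing_ZP _ sHG).
  case=> _ /morphimP[w Nw H'w ->]; rewrite -cosetX // => eqx.
  have [h Hh def_x] := kercoset_rcoset Nx (groupX p Nw) eqx.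
  by exists h; rewrite // def_x mulKg powZ.
case=> h Hh Zx; have H'h := subsetP sHH' h Hh.
have /imsetP[w H'w def_w] : h^-1 * x \in ppowers p H'.
  by apply: Z_root => //; rewrite groupM ?groupV.
exists (coset H w); first exact: mem_quotient.
by rewrite -cosetX // -def_w -(coset_kerl (h^-1 * x) Hh) mulKVg.
Qed.

(** The graph pairs h z with the coset of h, for h in H' and z in Z. A root w in H' of [h, k] serves
    both sides: w itself on the left, its coset on the right. *)
Lemma factor_section_iso :
  section_iso p (H' <*> Z) (H <*> Z) (H' / H) (ppowers p (H' / H)).
Proof.
pose R := [set u : gT * coset_of H |
  [exists h in H', (u.2 == coset H h) && (h^-1 * u.1 \in Z)]].
have RP x q : reflect (exists h, [/\ h \in H', q = coset H h & h^-1 * x \in Z]) ((x, q) \in R).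
  rewrite inE; apply: (iffP exists_inP) => /= [[h H'h /andP[/eqP-> Zx]] | [h [H'h -> Zx]]].
    by exists h.
  by exists h; rewrite ?eqxx.
have gR: group_set R.
  apply/group_setP; split=> [|[x q] [y r]].
    by apply/RP; exists 1; rewrite morph1 invg1 mulg1 !group1.
  case/RP=> h [H'h -> Zx] /RP[k [H'k -> Zy]]; apply/RP; exists (h * k).
  rewrite groupM // morphM ?(subsetP nHH') //; split=> //.
  have ->: (h * k)^-1 * (x * y) = (h^-1 * x) ^ k * (k^-1 * y).
    by rewrite conjgE invMg !mulgA mulgK.
  have Gk := subsetP sH'G k H'k.
  have -> : (h^-1 * x) ^ k = h^-1 * x by apply/conjg_fixP/commgP/(ambient_central Zx).
  exact: groupM.
apply/section_isoP; exists (Group gR); apply/section_graphP; split.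
- move=> x q /RP[h [H'h -> Zx]]; split; last 1 first.
  + rewrite coset_ppowers //; rewrite -(mulKVg h x) groupMr //.
    exact: (subsetP (joing_subr _ _)).
  + by apply/(joing_ZP _ sH'G); exists h.
  exact: mem_quotient.
- move=> x /(joing_ZP _ sH'G)[h H'h Zx]; exists (coset H h); apply/RP; by exists h.
- move=> _ /morphimP[h _ H'h ->]; exists h; apply/RP; exists h.
  by rewrite mulVg group1.
- move=> x _ /(joing_ZP _ sHG)[h Hh Zx] /imsetP[_ /morphimP[w _ H'w ->] ->].
  apply/RP; exists (h * w ^+ p); have H'h := subsetP sHH' h Hh.
  split; first by rewrite groupM ?groupX.
    by rewrite coset_kerl // cosetX.
  by rewrite invMg -mulgA groupM ?groupV ?powZ.
move=> x q y r /RP[h [H'h -> Zx]] /RP[k [H'k -> Zy]].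
have /imsetP[w H'w def_w] := hclass2_comm hH' H'h H'k.
exists w, (coset H w); split.
- by apply/RP; exists w; rewrite mulVg group1.
- by rewrite -def_w; apply: comm_mod_Z => //; apply: (subsetP sH'G).
by rewrite -cosetX // -def_w morphR ?(subsetP nHH').
Qed.

(** An ideal E in between gives B = (E cap H') / H, which need not belong to P. A lift T of B does,
    and it has the same p-th powers as B, so it is powerfully embedded in H' / H; simplicity leaves
    T = 1 or T = H' / H. *)
Lemma factor_maxideal : maxideal (H <*> Z) (H' <*> Z).
Proof.
have [cQ ntQ simpleQ] := simpleHH'.
have [sHZG sH'ZG] : H <*> Z \subset G /\ H' <*> Z \subset G.
  by rewrite !join_subG sHG sH'G ambient_Z_sub.
have pH'Z : pembed p (H' <*> Z) (H' <*> Z).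
  by apply: pembed_joing_Z => //; apply/pembedP; apply: (hclass2_comm hH').
split=> //.
- exact: joing_subr.
- by rewrite genS ?setSU.
(* If H Z = H' Z, every element of H' / H is a p-th power, hence also a p^2-th power, hence
   trivial. *)
- move/(congr1 val)=> /= eqHZ; case/negP: ntQ.
  have sQ : H' / H \subset ppowers p (H' / H).
    apply/subsetP=> _ /morphimP[x _ H'x ->].
    by rewrite coset_ppowers // eqHZ mem_gen // inE H'x.
  apply/eqP/trivgP/subsetP=> q Qq.
  have /imsetP[r Qr ->] := subsetP sQ q Qq; have /imsetP[s Qs ->] := subsetP sQ r Qr.
  by rewrite (hclass2_exp hQ) ?group1.
- exact: pembed_joing_Z.
move=> E sHE sEH' pE; have sEG := subset_trans sEH' sH'ZG.
have sZE := subset_trans (joing_subr _ _) sHE : Z \subset E.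
pose B := ((E :&: H') / H)%G.
have sHEH : H \subset E :&: H' by rewrite subsetI sHH' (subset_trans (joing_subl _ _) sHE).
have sBQ : B \subset H' / H by rewrite quotientS ?subsetIr.
have pB : pembed p B (H' / H).
  apply/pembedP=> _ _ /morphimP[e Ne /setIP[Ee H'e] ->] /morphimP[x Nx H'x ->].
  have /imsetP[w Ew def_w]: [~ e, x] \in ppowers p E.
    by apply: (pembedP _ _ _ pE) => //; rewrite mem_gen // inE H'x.
  (* The root w need not lie in H'; it is replaced by v in E cap H', congruent to it modulo Z and so
     with the same p-th power. *)
  have /(joing_ZP _ sH'G)[v H'v Zvw] := subsetP sEH' w Ew.
  have Ev : v \in E.
    by rewrite -(groupMr v (subsetP sZE _ Zvw)) mulKVg.
  have eq_vw : w ^+ p = v ^+ p by apply: expp_mod_Z => //; apply: (subsetP sH'G).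
  rewrite -morphR // def_w eq_vw /= cosetX // mem_ppowers //.
  by rewrite mem_quotient // inE Ev.
have [T [sTB sBT hT]] := hclass2_lift hQ sBQ (pembedP _ _ _ (pembedS sBQ pB)).
have sTQ := subset_trans sTB sBQ.
have eqBT := ppowers_mod hQ sBQ sTB sBT.
have nT : Defs.normalP p T (H' / H)%G.
  split=> //; first exact: hclass2_classP.
  split=> //; rewrite gen_subG /= (ppowersE hQ sTQ) -eqBT.
  apply/subsetP=> _ /imset2P[t q Tt Qq ->].
  by apply: (pembedP _ _ _ pB) => //; apply: (subsetP sTB).
have [eqT | neqT] := eqVneq T (H' / H)%G.
  right; apply/val_inj/eqP; rewrite eqEsubset sEH' /= join_subG sZE andbT.
  have : H' / H \subset (E :&: H') / H by rewrite -[H' / H]/(gval (H' / H)%G) -eqT.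
  by rewrite quotientSGK // subsetI => /andP[].
left; apply/val_inj/eqP; rewrite eqEsubset sHE andbT; apply/subsetP=> e Ee /=.
have /(joing_ZP _ sH'G)[v H'v Zve] := subsetP sEH' e Ee.
have Ev : v \in E.
  by rewrite -(groupMr v (subsetP sZE _ Zve)) mulKVg.
have T1 : T :=: 1 by apply: simpleQ.
(* With T = 1, all of B consists of p-th powers of H' / H, which means that E cap H' lies in H Z. *)
have : coset H v \in ppowers p (H' / H).
  have : coset H v \in B by rewrite mem_quotient // inE Ev.
  by move/(subsetP sBT); rewrite T1 mul1g.
rewrite coset_ppowers // => HZv; rewrite -(mulKVg v e) groupM //.
exact: (subsetP (joing_subr _ _)).
Qed.

End Factor.

End Ambient.

(** * Passage to series of ideals and conclusion *)

Lemma composition_series_mx_series (gT : finGroupType) (G : {group gT}) n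
    (H : nat -> {group gT}) (Z := pow_subgroup_group p 1 G)
    (Hb := fun i => (H i <*> Z)%G) :
    hclass2 p G -> powerful_composition_series p G n H ->
  [/\ mx_series (maxideal G) Z n Hb, Hb n = G
    & forall i, i < n -> [/\ maxideal G (Hb i) (Hb i.+1), hclass2 p (H i.+1 / H i)%G &
        section_iso p (Hb i.+1) (Hb i) (H i.+1 / H i) (ppowers p (H i.+1 / H i))]].
Proof.
move=> hG [H0 Hn stepH simpleH].
have sHS i : i < n -> H i \subset H i.+1 by case/stepH => -[_ _ []].
have sHG i : i <= n -> H i \subset G.
  (* Descending induction from [H n], which is G; once k reaches n, truncated subtraction makes the
     step trivial. *)
  move=> le_in; rewrite -(subKn le_in); elim: (n - i) => [|k IHk].
    by rewrite subn0 -Hn.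
  have [le_nk | lt_kn] := leqP n k.
    by rewrite (eqP (leqW le_nk : n - k.+1 == 0)); move: IHk; rewrite (eqP le_nk).
  by apply: subset_trans IHk; rewrite -(subnSK lt_kn) sHS // subnSK // leq_subr.
have factorH i : i < n -> [/\ maxideal G (Hb i) (Hb i.+1), hclass2 p (H i.+1 / H i)%G &
        section_iso p (Hb i.+1) (Hb i) (H i.+1 / H i) (ppowers p (H i.+1 / H i))].
  move=> lt_in; have [[cH cH' [sHH' pH]] _] := stepH i lt_in.
  have hH' := classP_hclass2 cH'; have hH := classP_hclass2 cH.
  have pHH' : pembed p (H i) (H i.+1).
    rewrite /pembed -(ppowersE hH (subxx _)).
    exact: subset_trans (subset_gen _) pH.
  split; [apply: factor_maxideal | | apply: factor_section_iso] => //;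
    try exact: sHG; try exact: simpleH.
  by case: (simpleH i lt_in) => /(classP_hclass2).
split=> //; last first.
  apply: val_inj; rewrite /= Hn; apply/joing_idPl; exact: ambient_Z_sub.
split; last by move=> i /factorH[].
by apply: val_inj; rewrite /= H0 joing1G.
Qed.

End OddPrime.

Theorem theorem6p9 (p : nat) (gT : finGroupType) (G : {group gT})
    (n m : nat) (H K : nat -> {group gT})
    (p_prime : prime p) (p_odd : odd p) (PG : classP p G)
    (serH : powerful_composition_series p G n H)
    (serK : powerful_composition_series p G m K) :
  m = n /\
  exists s : {perm 'I_n}, forall i : 'I_n,
    (H i.+1 / H i) \isog (K (s i).+1 / K (s i)).
Proof.
have hG := classP_hclass2 p_prime p_odd PG.
have [serHb HbG factH] := composition_series_mx_series p_prime p_odd hG serH.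
have [serKb KbG factK] := composition_series_mx_series p_prime p_odd hG serK.
set Hb := (fun i => _ : {group gT}) in serHb HbG factH.
set Kb := (fun i => _ : {group gT}) in serKb KbG factK.
pose lab (B A : {group gT}) := section_label p B A.
have [||||eq_nm permF] := @mx_jordan_holder _ _ (maxideal p G) (pow_subgroup_group p 1 G)
    lab _ _ _ n m Hb Kb serHb serKb; last first.
- subst m; split=> //; have [s eq_lab] := perm_eq_mkseq permF.
  exists s => i.
  have [mxH hQ isoH] := factH i (ltn_ord i).
  have [mxK hQ' isoK] := factK (s i) (ltn_ord (s i)).
  have isoHK := section_label_iso p_prime p_odd hG mxK (eq_lab i).
  apply: (section_iso_isog p_prime p_odd hQ hQ').
  (* The chain runs from the H-factor to its section of G, to the K-section, to the K-factor. Both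
     intermediate terms are sections of G above Z, where uniqueness of roots allows composing
     graphs. *)
  have [sZH _ sHG _ _ _ _] := mxH; have [sZK _ sKG _ _ _ _] := mxK.
  apply: (ambient_section_iso_trans p_prime p_odd hG sZK sKG) isoK; first exact: ppowers1.
  apply: (ambient_section_iso_trans p_prime p_odd hG sZH sHG) isoHK; first exact: ppowers1.
  exact: section_iso_sym.
- exact: etrans HbG (esym KbG).
- move=> A B [sZA sAB sBG _ pA _ _].
  apply: (maxideal_series_exists p_prime p_odd hG) => //; first exact: subset_trans sBG.
  exact: pembedS pA.
- exact: (maxideal_diamond p_prime p_odd hG).
move=> A [sZA sAZ _ neqAZ _ _ _]; apply: neqAZ; apply/val_inj/eqP.
by rewrite eqEsubset sAZ.
Qed.
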